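(* Let $\mathcal M(q)$ be a finite Möbius plane of order $q$. If $q\ge 4$, then \[\mu(\mathcal M(q))\le 2q-2+\left(2+\frac{14q^2-20q+6}{q^3-6q^2+11q-2}\right)\left(1+\log\left(\frac{q^6}{4}\right)\right).\] If $q\ge 156$, then $\mu(\mathcal M(q))\le 2q+12\log(q)$.
   Context: A Möbius plane is a pair $(\mathcal P,\mathcal Z)$, where $\mathcal P$ is a set (of points) and $\mathcal Z$ is a set of subsets of $\mathcal P$ (circles), such that: (i) any three pairwise distinct points lie on exactly one circle; (ii) if $z\in\mathcal Z$, $P\in z$ and $Q\in\mathcal P\setminus z$, there is exactly one circle $z'$ through $P$ and $Q$ with $z\cap z'=\{P\}$; (iii) there is at least one circle and every circle has at least three points; (iv) for every circle $z$ there is a point not on $z$. It is finite if $\mathcal P$ is finite; then all circles have the same number $q+1$ of points, and $q$ is the order. The point-circle incidence graph $G$ has vertex set $V=\mathcal P\cup\mathcal Z$ and edges $\{P,z\}$ with $P\in z$, with shortest-path distance $d$. A set $S\subseteq V$ resolves $W\subseteq V$ if for any two distinct $u,v\in W$ there is $s\in S$ with $d(u,s)\ne d(v,s)$; $S$ is a resolving set if it resolves $V$. $\mu(\mathcal M(q))$ denotes the metric dimension of $G$, i.e. the minimum cardinality of a resolving set of $G$. Here $\log$ is the natural logarithm. *)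

(* Defs.v *)
From mathcomp Require Import all_boot.

Set Implicit Arguments.
Unset Strict Implicit.
Unset Printing Implicit Defensive.

Section Graph.
Variables (V : finType) (e : rel V).

Definition has_walk (n : nat) (u v : V) : bool :=
  [exists p : n.-tuple V, path e u p && (last u p == v)].

(* The least n such that there is a walk of length n from u to v.  Restricting
   to n < #|V| loses nothing, since shortest walks have no repeated vertex; the
   value is #|V| (standing for infinity) when u and v are not connected. *)
Definition gdist (u v : V) : nat :=
  find (fun n => has_walk n u v) (iota 0 #|V|).

Definition resolves (S W : {set V}) : bool :=
  [forall u in W, forall v in W,
     (u != v) ==> [exists s in S, gdist u s != gdist v s]].

Definition resolving_set (S : {set V}) : bool := resolves S [set: V].

(* The default [set: V] is itself resolving: see resolving_setT. *)
Definition metric_dim : nat :=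
  #|[arg min_(S < [set: V] | resolving_set S) #|S|]|.

Lemma has_walkP n u v :
  reflect (exists p : seq V, [/\ size p = n, path e u p & last u p = v])
          (has_walk n u v).
Proof.
apply: (iffP existsP) => [[p /andP[pp /eqP lp]]|[p [sp pp lp]]].
  by exists p; rewrite size_tuple.
by have sp' : size p == n by [apply/eqP]; exists (Tuple sp'); rewrite /= pp lp /=.
Qed.

Lemma gdist_le n u v : has_walk n u v -> gdist u v <= n.
Proof.
rewrite /gdist => wn; case: (ltnP n #|V|) => [ltn|]; last first.
  by apply: leq_trans; rewrite -[leqRHS](size_iota 0); apply: find_size.
rewrite leqNgt; apply/negP => /(before_find 0).
by rewrite nth_iota // add0n wn.
Qed.

Lemma gdist_walk u v : connect e u v -> has_walk (gdist u v) u v.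
Proof.
move=> /connectP[p0 pp0 ->]; case/shortenP: pp0 => p pp up _.
have lt_p : size p < #|V| by rewrite -(card_uniqP up : _ = (size p).+1) max_card.
have hs : has (fun n => has_walk n u (last u p)) (iota 0 #|V|).
  apply/hasP; exists (size p); first by rewrite mem_iota.
  by apply/has_walkP; exists p.
have := nth_find 0 hs; rewrite nth_iota //.
by rewrite -[ltnRHS](size_iota 0) -has_find.
Qed.

Lemma gdist_eq0 u v : (gdist u v == 0) = (u == v).
Proof.
apply/idP/idP => [|/eqP->]; last first.
  by rewrite -leqn0; apply: gdist_le; apply/has_walkP; exists [::].
rewrite /gdist; have: 0 < #|V| by apply/card_gt0P; exists u.
case: #|V| => // n _ /=; case: ifP => // /has_walkP[p [/size0nil-> _ /= ->]] //.
Qed.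

Lemma resolving_setT : resolving_set [set: V].
Proof.
apply/forall_inP => u _; apply/forall_inP => v _; apply/implyP => uv.
apply/exists_inP; exists u; rewrite ?inE //.
have /eqP-> : gdist u u == 0 by rewrite gdist_eq0.
by rewrite eq_sym gdist_eq0 eq_sym.
Qed.

Lemma metric_dimP :
  (exists2 S, resolving_set S & metric_dim = #|S|) /\
  (forall S, resolving_set S -> metric_dim <= #|S|).
Proof.
rewrite /metric_dim; case: arg_minnP => [|S rS minS]; first exact: resolving_setT.
by split=> //; exists S.
Qed.

End Graph.

Section MoebiusPlane.
Variables (P : finType) (Z : {set {set P}}).

Record moebius_plane : Prop := MoebiusPlane {
  moebius_three_points : forall A B C : P, A != B -> A != C -> B != C ->
    exists! z : {set P}, [/\ z \in Z, A \in z, B \in z & C \in z];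
  moebius_tangent : forall (z : {set P}) (A B : P),
    z \in Z -> A \in z -> B \notin z ->
    exists! z' : {set P},
      [/\ z' \in Z, A \in z', B \in z' & z :&: z' = [set A]];
  moebius_circle : exists z : {set P}, z \in Z;
  moebius_circle_card : forall z : {set P}, z \in Z -> 3 <= #|z|;
  moebius_off_circle : forall z : {set P}, z \in Z -> exists A : P, A \notin z
}.

Definition moebius_order (q : nat) : Prop :=
  forall z : {set P}, z \in Z -> #|z| = q.+1.

Definition inc_vertex : finType := (P + {z : {set P} | z \in Z})%type.

Definition inc_graph : rel inc_vertex := fun u v =>
  match u, v with
  | inl A, inr z => A \in val z
  | inr z, inl A => A \in val z
  | _, _ => false
  end.

End MoebiusPlane.

(* Main.v *)
Require Import Defs.
From mathcomp Require Import all_boot all_order all_algebra.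
From mathcomp Require Import reals exp.
From mathcomp Require Import zify ring lra.
Import Order.TTheory GRing.Theory Num.Theory.

(** Any two points are separated by one of 2(q-1) circles through a fixed point p:
    in the affine plane of order q derived at p, two parallel classes with one line
    removed from each determine a point by its incidences.

    Two distinct circles c, c' are separated by every circle z that meets exactly one
    of them, and at least (q^2-1)(q-3)/2 circles do.  Indeed, for A, B on c but not on
    c', the q circles other than c through A and B cover c' minus c, each in at most
    two points, so about half of them miss c'; the exact number depends on how many
    are tangent to c', and through A there are only q+1 tangents to c'.  On the other
    hand one circle separates at most N^2/4 of the pairs of circles, N = q(q^2+1).  The
    greedy covering bound then yields a family of at most
    N / ((q^2-1)(q-3)/2) * (1 + ln (N^2/4)) circles separating all pairs, which is
    below the logarithmic term claimed.  A point and a circle are told apart by the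
    parity of their distances to any vertex. *)

Set Implicit Arguments.
Unset Strict Implicit.
Unset Printing Implicit Defensive.

Lemma card_ex_unique (T : finType) (Q : T -> Prop) (E : {set T}) :
  (exists! x, Q x) -> (forall x, reflect (Q x) (x \in E)) -> #|E| = 1.
Proof.
move=> [x [Qx ux]] rE; suff -> : E = [set x] by rewrite cards1.
apply/setP=> y; rewrite inE; apply/idP/eqP => [/rE /ux -> //|->]; exact/rE.
Qed.

(** * Counting points, circles, pencils and tangents in a Möbius plane of order [q] *)

Section MoebiusCounting.
Variables (P : finType) (Z : {set {set P}}) (q : nat).
Hypotheses (hM : moebius_plane Z) (hq : moebius_order Z q).

Lemma sum_card_setI (E : {set {set P}}) (D : {set P}) :
  \sum_(z in E) #|z :&: D| = \sum_(X in D) #|[set z in E | X \in z]|.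
Proof.
under eq_bigr do rewrite -sum1_card big_mkcond /=.
rewrite exchange_big /= [RHS]big_mkcond; apply: eq_bigr => X _.
rewrite -sum1_card; case: ifP => XD; last first.
  by rewrite big1 // => z _; rewrite inE XD andbF.
rewrite [LHS]big_mkcond [RHS]big_mkcond; apply: eq_bigr => z _.
by rewrite !inE XD andbT; case: (z \in E).
Qed.

Definition pencil (A B : P) : {set {set P}} :=
  [set z in Z | (A \in z) && (B \in z)].

(** For [A] on [c], these are the lines parallel to [c], other than [c] itself, in the affine plane
    derived at [A]. *)
Definition tangents (c : {set P}) (A : P) : {set {set P}} :=
  [set z in Z | c :&: z == [set A]].

Lemma circle_unique (z z' : {set P}) (A B C : P) :
  z \in Z -> z' \in Z -> A != B -> A != C -> B != C ->
  A \in z -> B \in z -> C \in z -> A \in z' -> B \in z' -> C \in z' -> z = z'.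
Proof.
move=> hz hz' nAB nAC nBC *; have [w [_ uw]] := moebius_three_points hM nAB nAC nBC.
by rewrite -(uw z) ?(uw z').
Qed.

Lemma card_circleI (z z' : {set P}) :
  z \in Z -> z' \in Z -> z != z' -> #|z :&: z'| <= 2.
Proof.
move=> hz hz' nzz; rewrite leqNgt; apply: contra nzz => /card_gt2P.
case=> A [B [C [[]]]]; rewrite !inE => /andP[? ?] /andP[? ?] /andP[? ?].
move=> [nAB nBC CA]; apply/eqP; apply: (@circle_unique _ _ A B C) => //.
by rewrite eq_sym.
Qed.

Lemma pencil_through A B C : A != B -> A != C -> B != C ->
  #|[set z in pencil A B | C \in z]| = 1.
Proof.
move=> nAB nAC nBC; apply: card_ex_unique (moebius_three_points hM nAB nAC nBC) _ => z.
rewrite !inE -!andbA; apply: (iffP and4P); case; by split.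
Qed.

Lemma sum_pencil A B (D : {set P}) : A != B -> A \notin D -> B \notin D ->
  \sum_(z in pencil A B) #|z :&: D| = #|D|.
Proof.
move=> nAB AD BD; rewrite sum_card_setI -sum1_card; apply: eq_bigr => X XD.
by apply: pencil_through => //; apply: contraTneq XD => <-.
Qed.

Lemma tangents_through c A B : c \in Z -> A \in c -> B \notin c ->
  #|[set z in tangents c A | B \in z]| = 1.
Proof.
move=> cZ Ac Bc; apply: card_ex_unique (moebius_tangent hM cZ Ac Bc) _ => z.
rewrite !inE; apply: (iffP andP) => [[/andP[zZ /eqP e] Bz]|[zZ Az Bz ->]].
  by split=> //; have : A \in c :&: z by [rewrite e inE]; rewrite inE => /andP[].
by rewrite zZ Bz eqxx.
Qed.

Lemma tangent_mem c A z : z \in tangents c A -> A \in z.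
Proof.
rewrite inE => /andP[_ /eqP e].
by have : A \in c :&: z by [rewrite e inE]; rewrite inE => /andP[].
Qed.

Lemma tangent_unique c A B z z' : c \in Z -> A \in c -> B \notin c ->
  z \in tangents c A -> z' \in tangents c A -> B \in z -> B \in z' -> z = z'.
Proof.
move=> cZ Ac Bc hz hz' Bz Bz'.
have /eqP/cards1P[w ew] := tangents_through cZ Ac Bc.
have : z \in [set w] by rewrite -ew inE hz.
have : z' \in [set w] by rewrite -ew inE hz'.
by rewrite !inE => /eqP-> /eqP->.
Qed.

Lemma tangent_exists c A B : c \in Z -> A \in c -> B \notin c ->
  exists2 z, z \in tangents c A & B \in z.
Proof.
move=> cZ Ac Bc; have /eqP/cards1P[w ew] := tangents_through cZ Ac Bc.
have : w \in [set w] by rewrite inE.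
by rewrite -ew inE => /andP[]; exists w.
Qed.

Lemma circle_through A B C : A != B -> A != C -> B != C ->
  exists z, [/\ z \in Z, A \in z, B \in z & C \in z].
Proof.
by move=> nAB nAC nBC; have [z [? _]] := moebius_three_points hM nAB nAC nBC; exists z.
Qed.

Lemma order_gt1 : 1 < q.
Proof.
by have [z zZ] := moebius_circle hM; have := moebius_circle_card hM zZ; rewrite hq.
Qed.

Lemma exists_third A B : exists2 C : P, A != C & B != C.
Proof.
have [z zZ] := moebius_circle hM; have z3 := moebius_circle_card hM zZ.
have : 0 < #|z :\: [set A; B]|.
  have := cardsID [set A; B] z; have := subset_leq_card (subsetIr z [set A; B]).
  rewrite cards2; lia.
case/card_gt0P=> C; rewrite !inE negb_or => /andP[/andP[? ?] _].
by exists C; rewrite eq_sym.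
Qed.

Lemma circle_avoiding A B : A != B ->
  exists z, [/\ z \in Z, A \in z & B \notin z].
Proof.
move=> nAB; have [C nAC nBC] := exists_third A B.
have [z [zZ Az Bz Cz]] := circle_through nAB nAC nBC.
have [D Dz] := moebius_off_circle hM zZ.
have AD : A != D by apply: contraNneq Dz => <-.
have BD : B != D by apply: contraNneq Dz => <-.
have CD : C != D by apply: contraNneq Dz => <-.
have [w [wZ Aw Cw Dw]] := circle_through nAC AD CD.
exists w; split=> //; apply/negP => Bw; move: Dz.
by rewrite (@circle_unique z w A B C) ?Dw.
Qed.

(** Take [c] through [A] but not [B]. The circles of the pencil partition the [q] points of
    [c :\ A], at most one point each; the only one that gets none is the tangent to [c] at [A]
    through [B]. *)
Lemma card_pencil A B : A != B -> #|pencil A B| = q.+1.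
Proof.
move=> nAB; have [c [cZ Ac Bc]] := circle_avoiding nAB.
have := @sum_pencil A B (c :\ A) nAB.
rewrite !inE eqxx /= (negPf Bc) andbF => /(_ isT isT) e.
have := cardsD1 A c; rewrite Ac hq // -{}e => ->.
have := tangents_through cZ Ac Bc; rewrite -sum1_card => /esym e.
rewrite addnC {}[X in _ + X]e -[LHS]sum1_card.
have -> : \sum_(z in [set z in tangents c A | B \in z]) 1
          = \sum_(z in pencil A B) (c :&: z == [set A]).
  rewrite [LHS]big_mkcond [RHS]big_mkcond; apply: eq_bigr => z _.
  rewrite !inE; case: (z \in Z) => //=; case: eqP => [e|] /=; last by case: ifP.
  suff -> : A \in z by [].
  by have : A \in c :&: z by [rewrite e inE]; rewrite inE => /andP[].
rewrite -big_split /=.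
apply: eq_bigr => z; rewrite inE => /and3P[zZ Az Bz].
have nzc : z != c by apply: contraNneq Bc => <-.
have := card_circleI zZ cZ nzc.
rewrite (cardsD1 A) !inE Az Ac /= => le.
rewrite setIDA.
case: eqP => [e|ne].
  by rewrite setIC e setDv cards0.
suff : 0 < #|(z :&: c) :\ A| by lia.
rewrite card_gt0; apply/negP => /eqP e; apply: ne.
by rewrite setIC -(setD1K (_ : A \in z :&: c)) ?e ?setU0 // inE Az.
Qed.

(** The [q.+1] circles of a pencil partition the points other than [A] and [B] into sets of size
    [q.-1]. *)
Lemma card_points : #|P| = q ^ 2 + 1.
Proof.
have [z zZ] := moebius_circle hM.
have /card_gt1P[A [B [Az Bz nAB]]] : 1 < #|z| by rewrite hq //; have := order_gt1; lia.
have := @sum_pencil A B (~: [set A; B]) nAB; rewrite !inE !eqxx orbT => /(_ isT isT).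
have -> : \sum_(z in pencil A B) #|z :&: ~: [set A; B]| = \sum_(z in pencil A B) q.-1.
  apply: eq_bigr => w; rewrite inE => /and3P[wZ Aw Bw].
  have := cardsID [set A; B] w; rewrite setDE (hq wZ).
  have -> : w :&: [set A; B] = [set A; B].
    by apply/setIidPr/subsetP => X; rewrite !inE => /orP[]/eqP->.
  by rewrite cards2 nAB; lia.
rewrite sum_nat_const card_pencil //; have := cardsC [set A; B]; rewrite cards2 nAB /=.
have := order_gt1; nia.
Qed.

Lemma card_circles_through A : #|[set z in Z | A \in z]| = q * q.+1.
Proof.
have := sum_card_setI [set z in Z | A \in z] [set~ A].
have -> : \sum_(z in [set z in Z | A \in z]) #|z :&: [set~ A]|
        = \sum_(z in [set z in Z | A \in z]) q.
  apply: eq_bigr => z; rewrite inE => /andP[zZ Az].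
  by have := cardsD1 A z; rewrite Az (hq zZ) setDE => -[].
have -> : \sum_(X in [set~ A]) #|[set z in [set z in Z | A \in z] | X \in z]|
        = \sum_(X in [set~ A]) q.+1.
  apply: eq_bigr => X; rewrite !inE => XA; rewrite -(@card_pencil A X) 1?eq_sym //.
  by apply: eq_card => z; rewrite !inE -andbA.
rewrite !sum_nat_const cardsC1 card_points addn1 /= => e.
have q1 := order_gt1; apply/eqP; rewrite -(eqn_pmul2r (_ : 0 < q)) ?e; lia.
Qed.

Lemma card_circles : #|Z| = q * (q ^ 2 + 1).
Proof.
have := sum_card_setI Z setT.
under eq_bigr => z zZ do rewrite setIT hq //.
under [X in _ = X]eq_bigr do rewrite card_circles_through.
rewrite !sum_nat_const cardsT card_points => e; apply/eqP.
rewrite -(eqn_pmul2r (_ : 0 < q.+1)) // e; apply/eqP; lia.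
Qed.

(** The tangents at [A] partition the [q ^ 2 - q] points off [c], with [q] points on each. *)
Lemma card_tangents c A : c \in Z -> A \in c -> #|tangents c A| = q.-1.
Proof.
move=> cZ Ac; have := sum_card_setI (tangents c A) (~: c).
have -> : \sum_(z in tangents c A) #|z :&: ~: c| = \sum_(z in tangents c A) q.
  apply: eq_bigr => z; rewrite inE => /andP[zZ /eqP e].
  by have := cardsID c z; rewrite setIC e cards1 (hq zZ) setDE => -[].
have -> : \sum_(X in ~: c) #|[set z in tangents c A | X \in z]| = \sum_(X in ~: c) 1.
  by apply: eq_bigr => X; rewrite inE => Xc; apply: tangents_through.
rewrite !sum_nat_const; have := cardsC c; rewrite hq // card_points => hc e.
have q1 := order_gt1; apply/eqP; rewrite -(eqn_pmul2r (_ : 0 < q)) ?e; nia.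
Qed.

End MoebiusCounting.

(** * Families of circles that separate two circles or two points *)

Section CirclePairs.
Variables (P : finType) (Z : {set {set P}}) (q : nat).
Hypotheses (hM : moebius_plane Z) (hq : moebius_order Z q).

(** Sort these circles by their point of contact: each of the [q.+1] points of [c] has a single
    tangent through [A]. *)
Lemma card_tangent_circles_through c A : c \in Z -> A \notin c ->
  #|[set z in Z | (A \in z) && (#|z :&: c| == 1)]| <= q.+1.
Proof.
move=> cZ Ac; set E := [set z in Z | _].
have -> : #|E| = \sum_(z in E) #|z :&: c|.
  by rewrite -sum1_card; apply: eq_bigr => z; rewrite inE => /and3P[_ _ /eqP].
rewrite sum_card_setI -(hq cZ) -sum1_card; apply: leq_sum => X Xc.
rewrite -(tangents_through hM cZ Xc Ac); apply/subset_leq_card/subsetP => z.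
rewrite !inE => /andP[/and3P[zZ Az /cards1P[Y e]] Xz]; rewrite zZ Az setIC e andbT /=.
have : X \in z :&: c by rewrite inE Xz.
by rewrite e inE => /eqP->.
Qed.

Lemma card_circleD c c' : c \in Z -> c' \in Z -> #|c :\: c'| = #|c' :\: c|.
Proof.
move=> cZ cZ'; have := cardsID c' c; have := cardsID c c'.
by rewrite setIC (hq cZ) (hq cZ'); lia.
Qed.

(** Each of the [q] circles contributes 2, written as [2 * (k == 0) + (k == 1) + k] with
    [k = #|z :&: c'|] at most 2. The values [k] add up to [#|c' :\: c|]. *)
Lemma pencil_missing c c' A B : c \in Z -> c' \in Z ->
  A \in c :\: c' -> B \in c :\: c' -> A != B ->
  2 * #|[set z in pencil Z A B :\ c | z :&: c' == set0]|
  + #|[set z in pencil Z A B :\ c | #|z :&: c'| == 1]| + #|c :\: c'| = 2 * q.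
Proof.
move=> cZ cZ'; rewrite !inE => /andP[Ac' Ac] /andP[Bc' Bc] nAB.
have cE : c \in pencil Z A B by rewrite inE cZ Ac Bc.
have cardE : #|pencil Z A B :\ c| = q.
  by have := cardsD1 c (pencil Z A B); rewrite cE (card_pencil hM hq nAB) => -[].
(* Such a [z] meets [c] only in [A] and [B], which are off [c']; so all its points on [c'] lie in
   [c' :\: c]. *)
have sumE : \sum_(z in pencil Z A B :\ c) #|z :&: c'| = #|c :\: c'|.
  rewrite card_circleD // -(@sum_pencil _ _ hM A B) ?inE ?Ac ?Bc //.
  rewrite (bigD1 c cE) /= [X in _ = X + _](_ : _ = 0) ?add0n; last first.
    by apply/eqP; rewrite cards_eq0; apply/eqP/setP => X; rewrite !inE; case: (X \in c).
  rewrite (eq_bigl (fun z => (z \in pencil Z A B) && (z != c))); last first.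
    by move=> z; rewrite !inE andbC.
  apply: eq_bigr => z; rewrite inE => /andP[/and3P[zZ Az Bz] zc].
  apply: eq_card => X; rewrite !inE; case: (boolP (X \in z)) => //= Xz.
  case: (boolP (X \in c')) => [Xc'|]; rewrite ?andbF // andbT.
  apply/esym/negP => Xc; move/eqP: zc; apply.
  apply: (circle_unique hM zZ cZ nAB _ _ Az Bz Xz) => //.
    by apply: contraNneq Ac' => ->.
  by apply: contraNneq Bc' => ->.
rewrite -sumE -!sum1_card -[in RHS]cardE mulnC big_distrl /=.
have condE (p : pred {set P}) : \sum_(z in [set z in pencil Z A B :\ c | p z]) 1
    = \sum_(z in pencil Z A B :\ c) p z.
  by rewrite -big_mkcondr /=; apply: eq_bigl => z; rewrite inE.
have condE2 (p : pred {set P}) : \sum_(z in [set z in pencil Z A B :\ c | p z]) 1 * 2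
    = \sum_(z in pencil Z A B :\ c) (p z) * 2.
  by rewrite -!big_distrl condE.
rewrite condE2 condE -!big_split /= mulnC -sum_nat_const.
apply: eq_bigr => z; rewrite !inE => /and4P[zc zZ Az Bz].
have zc' : z != c' by apply: contraNneq Ac' => <-.
have := card_circleI hM zZ cZ' zc'; rewrite -cards_eq0.
by case: #|_| => [|[|[|]]].
Qed.

(** Sum [pencil_missing] over the ordered pairs of distinct points of [c :\: c']. A circle other
    than [c] has at most two points on [c], so it occurs for at most one [B] once [A] is fixed, and
    for at most two [A]; through each [A] at most [q.+1] circles are tangent to [c']. *)
Lemma secants_missing c c' : c \in Z -> c' \in Z -> c != c' ->
  #|c :\: c'| * (#|c :\: c'|.-1 * (2 * q)) <=
  4 * #|[set z in Z | (z :&: c != set0) && (z :&: c' == set0)]|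
  + #|c :\: c'| * (q.+1 + #|c :\: c'|.-1 * #|c :\: c'|).
Proof.
move=> cZ cZ' cc'; set D := c :\: c'; set n := #|D|.
pose miss A := [set z in Z | [&& A \in z, z != c & z :&: c' == set0]].
pose tang A := [set z in Z | [&& A \in z, z != c & #|z :&: c'| == 1]].
have sub1 A (E : {set {set P}}) : A \in D ->
    {in E, forall z, [&& z \in Z, A \in z & z != c]} ->
    \sum_(B in D :\ A) #|[set z in E | B \in z]| <= #|E|.
  move=> AD hE; rewrite -sum_card_setI -sum1_card; apply: leq_sum => z /hE.
  case/and3P=> zZ Az zc; have := card_circleI hM zZ cZ zc.
  rewrite (cardsD1 A) !inE Az /=; have := AD; rewrite !inE => /andP[_ ->].
  rewrite add1n ltnS; apply: leq_trans; apply/subset_leq_card/subsetP => X.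
  by rewrite !inE => /and3P[-> -> /andP[_ ->]].
have step A : A \in D -> n.-1 * (2 * q) <= 2 * #|miss A| + (q.+1 + n.-1 * n).
  move=> AD; have cDA : #|D :\ A| = n.-1 by rewrite /n (cardsD1 A D) AD.
  rewrite -cDA -!sum_nat_const.
  have -> : \sum_(B in D :\ A) (2 * q) =
      2 * \sum_(B in D :\ A) #|[set z in miss A | B \in z]|
      + \sum_(B in D :\ A) #|[set z in tang A | B \in z]| + \sum_(B in D :\ A) n.
    rewrite big_distrr /= -!big_split /=; apply: eq_bigr => B; rewrite in_setD1.
    case/andP=> BA BD; rewrite -(pencil_missing cZ cZ' AD BD) 1?eq_sym //.
    congr (2 * _ + _ + _); apply: eq_card => z; rewrite !inE.
      by case: (z \in Z); case: (A \in z); case: (B \in z); case: (z == c);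
        case: (_ == set0).
    by case: (z \in Z); case: (A \in z); case: (B \in z); case: (z == c);
        case: (_ == 1).
  rewrite addnA leq_add2r; apply: leq_add.
    rewrite leq_mul2l /=; apply: sub1 => // z; rewrite inE => /and4P[-> -> -> _] //.
  apply: leq_trans (sub1 A (tang A) AD _) _ => [z|].
    by rewrite inE => /and4P[-> -> -> _].
  have := AD; rewrite inE => /andP[Ac' _].
  apply: leq_trans (card_tangent_circles_through cZ' Ac').
  apply/subset_leq_card/subsetP => z; rewrite !inE => /and4P[-> -> _ ->] //.
have : \sum_(A in D) (n.-1 * (2 * q)) <=
    \sum_(A in D) (2 * #|miss A| + (q.+1 + n.-1 * n)).
  by apply: leq_sum => A; apply: step.
rewrite sum_nat_const big_split /= sum_nat_const -big_distrr /= => /leq_trans; apply.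
rewrite leq_add2r -[4]/(2 * 2) -mulnA leq_mul2l /=.
set M := [set z in Z | _].
pose M' := [set z in M | z != c].
have -> : \sum_(A in D) #|miss A| = \sum_(A in D) #|[set z in M' | A \in z]|.
  apply: eq_bigr => A; rewrite inE => /andP[_ Ac]; apply: eq_card => z; rewrite !inE.
  case: (boolP (A \in z)) => [Az|]; rewrite ?andbF // andbT /=.
  have -> : z :&: c != set0 by apply/set0Pn; exists A; rewrite inE Az.
  by case: (z \in Z); case: (z == c); case: (_ == set0).
rewrite -sum_card_setI mulnC.
apply: (@leq_trans (#|M'| * 2)); last first.
  by rewrite leq_mul2r; apply/subset_leq_card/subsetP => z; rewrite inE => /andP[].
rewrite -sum_nat_const; apply: leq_sum => z; rewrite !inE => /andP[/and3P[zZ _ _] zc].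
apply: leq_trans (card_circleI hM zZ cZ zc); apply/subset_leq_card/subsetP => X.
by rewrite !inE => /and3P[-> _ ->].
Qed.

Lemma card_secants_missing c c' : 3 <= q -> c \in Z -> c' \in Z -> c != c' ->
  (q ^ 2 - 1) * (q - 3) <=
  4 * #|[set z in Z | (z :&: c != set0) && (z :&: c' == set0)]|.
Proof.
move=> q3 cZ cZ' cc'; have := secants_missing cZ cZ' cc'.
have := card_circleI hM cZ cZ' cc'; have := cardsID c' c; rewrite (hq cZ).
set m := #|[set z in Z | _]|.
move: #|c :&: c'| #|c :\: c'| m => k n m kn k2 le.
(* The substitution removes truncated subtraction. The case [k = 2], where [n = q - 1], is the worst
   and gives the bound exactly. *)
have [Q eQ] : exists Q, q = Q + 3 by exists (q - 3); lia.
have -> : (q ^ 2 - 1) * (q - 3) = (Q + 2) * (Q + 4) * Q.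
  rewrite eQ addnK; congr (_ * _).
  rewrite (_ : (Q + 3) ^ 2 = (Q + 2) * (Q + 4) + 1) ?addnK //.
  by rewrite expnS expn1; lia.
subst q; case: k k2 kn => [|[|[|//]]] _ kn.
- have en : n = Q + 4 by lia.
  by rewrite en addnS /= in le; lia.
- have en : n = Q + 3 by lia.
  by rewrite en addnS /= in le; lia.
- have en : n = Q + 2 by lia.
  by rewrite en addnS /= in le; lia.
Qed.

(** Distinct circles that meet are at distance 2 in the incidence graph, disjoint ones farther
    apart; so such a [z] resolves [c] and [c']. *)
Definition separates (z c c' : {set P}) : bool :=
  (z :&: c == set0) != (z :&: c' == set0).

Lemma card_separating c c' : 3 <= q -> c \in Z -> c' \in Z -> c != c' ->
  (q ^ 2 - 1) * (q - 3) <= 2 * #|[set z in Z | separates z c c']|.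
Proof.
move=> q3 cZ cZ' cc'; have h1 := card_secants_missing q3 cZ cZ' cc'.
have := card_secants_missing q3 cZ' cZ; rewrite eq_sym => /(_ cc') h2.
set E1 := [set z in Z | _] in h1; set E2 := [set z in Z | _] in h2.
have dis : [disjoint E1 & E2].
  rewrite -setI_eq0; apply/eqP/setP => z; rewrite !inE.
  by case: (_ :&: c == _); rewrite ?andbF.
have -> : [set z in Z | separates z c c'] = E1 :|: E2.
  apply/setP => z; rewrite !inE /separates -andb_orr; congr (_ && _).
  by case: (_ :&: c == _); case: (_ :&: c' == _).
have := cardsUI E1 E2; rewrite (eqP (_ : E1 :&: E2 == set0)) ?setI_eq0 //.
by rewrite cards0; lia.
Qed.

(** The family consists of the tangents at [p] to two circles [c1] and [c2] through [p] and [r]; as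
    these share [r], they represent different parallel classes at [p]. *)
Lemma points_separated_by_circles : 3 <= q ->
  exists S : {set {set P}}, [/\ S \subset Z, #|S| <= 2 * q - 2, S != set0 &
    forall A B, A != B -> exists2 z, z \in S & (A \in z) != (B \in z)].
Proof.
move=> q3; have q2 : 1 < q.-1 by lia.
have q2E : q.-1 + q.-1 = 2 * q - 2 by lia.
have [z0 z0Z] := moebius_circle hM.
have /card_gt1P[p [r [pz0 rz0 pr]]] : 1 < #|z0|.
  by rewrite hq // ltnS; apply: leq_trans q3.
have /card_gt1P[c1 [c2 [c1E c2E c12]]] : 1 < #|pencil Z p r|.
  by rewrite (card_pencil hM hq pr) ltnS; apply: leq_trans q3.
move: c1E c2E; rewrite !inE => /and3P[c1Z pc1 rc1] /and3P[c2Z pc2 rc2].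
have card_t c : c \in Z -> p \in c -> #|tangents Z c p| = q.-1.
  exact: (card_tangents hM hq).
exists (tangents Z c1 p :|: tangents Z c2 p); split.
- by apply/subsetP => z; rewrite !inE => /orP[]/andP[].
- by rewrite cardsU !card_t // q2E leq_subr.
- have /card_gt0P[z zt] : 0 < #|tangents Z c1 p| by rewrite card_t // ltnW.
  by apply/set0Pn; exists z; rewrite in_setU zt.
(* A point other than [p] on no tangent must lie on the removed line [c], so points with equal
   incidences share a line of the class. *)
have line c A B : c \in Z -> p \in c -> A != p -> B != p ->
    (forall z, z \in tangents Z c p -> (A \in z) = (B \in z)) ->
    exists2 z, z \in c |: tangents Z c p & (A \in z) && (B \in z).
  move=> cZ pc Ap Bp same; have [Ac|Ac] := boolP (A \in c).
    exists c; rewrite ?inE ?eqxx // Ac; apply/negPn/negP => Bc.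
    have [z zt Bz] := tangent_exists hM cZ pc Bc.
    have Az : A \in z by rewrite same.
    have : A \in c :&: z by rewrite inE Ac.
    by have := zt; rewrite inE => /andP[_ /eqP->]; rewrite inE (negPf Ap).
  have [z zt Az] := tangent_exists hM cZ pc Ac.
  by exists z; [rewrite in_setU1 zt orbT | rewrite -same // Az].
(* All circles of the family contain [p], so [p] is told from [A] by one that misses [A]; two
   tangents at [p] have no other common point. *)
have sepp A : A != p -> exists2 z, z \in tangents Z c1 p & A \notin z.
  move=> Ap; have : 1 < #|tangents Z c1 p| by rewrite card_t.
  case/card_gt1P=> z1 [z2 [t1 t2 z12]].
  have [Az1|] := boolP (A \in z1); last by exists z1.
  have [Az2|] := boolP (A \in z2); last by exists z2.
  have Ac1 : A \notin c1.
    apply/negP => Ac; have : A \in c1 :&: z1 by rewrite inE Ac.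
    by have := t1; rewrite inE => /andP[_ /eqP->]; rewrite inE (negPf Ap).
  by move: z12; rewrite (tangent_unique hM c1Z pc1 Ac1 t1 t2 Az1 Az2) eqxx.
move=> A B nAB.
have [eA|Ap] := eqVneq A p.
  have [|z zt Bz] := sepp B; first by rewrite -eA eq_sym.
  by exists z; rewrite ?in_setU ?zt // eA (tangent_mem zt) (negPf Bz).
have [eB|Bp] := eqVneq B p.
  have [z zt Az] := sepp A Ap.
  by exists z; rewrite ?in_setU ?zt // eB (tangent_mem zt) (negPf Az).
apply/exists_inP/contraT; rewrite negb_exists => /forallP same.
have same1 z : z \in tangents Z c1 p -> (A \in z) = (B \in z).
  by move=> zt; apply/eqP/negPn; have := same z; rewrite in_setU zt.
have same2 z : z \in tangents Z c2 p -> (A \in z) = (B \in z).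
  by move=> zt; apply/eqP/negPn; have := same z; rewrite in_setU zt orbT.
have [z1 z1t /andP[Az1 Bz1]] := line c1 A B c1Z pc1 Ap Bp same1.
have [z2 z2t /andP[Az2 Bz2]] := line c2 A B c2Z pc2 Ap Bp same2.
have onp c z : c \in Z -> p \in c -> z \in c |: tangents Z c p ->
    (z \in Z) && (p \in z).
  move=> cZ pc; rewrite in_setU1 => /orP[/eqP->|zt]; first by rewrite cZ.
  by rewrite (tangent_mem zt) andbT; have := zt; rewrite inE => /andP[].
have /andP[z1Z pz1] := onp _ _ c1Z pc1 z1t.
have /andP[z2Z pz2] := onp _ _ c2Z pc2 z2t.
have e12 : z1 = z2.
  by apply: (circle_unique hM z1Z z2Z nAB Ap Bp).
have nr (c c' : {set P}) : r \in c -> r \in c' -> (c :&: c' == [set p]) = false.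
  move=> rc rc'; apply/negP => /eqP e; have : r \in c :&: c' by rewrite inE rc.
  by rewrite e inE eq_sym (negPf pr).
move: z1t z2t; rewrite -e12 !in_setU1 => /orP[/eqP e1|t1] /orP[/eqP e2|t2].
- by move: c12; rewrite -e1 -e2 eqxx.
- by move: t2; rewrite e1 inE nr ?andbF.
- by move: t1; rewrite e2 inE nr ?andbF.
have rz1 : r \notin z1.
  by apply/negP => rz1; move: t1; rewrite inE nr ?andbF.
(* Now [c1] and [c2] are both tangent to [z1] at [p] and pass through [r], so they coincide. *)
move: t1 t2; rewrite !inE => /andP[_ t1] /andP[_ t2].
case/negP: c12; apply/eqP; apply: (tangent_unique hM z1Z pz1 rz1) => //.
  by rewrite inE c1Z setIC.
by rewrite inE c2Z setIC.
Qed.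

End CirclePairs.

(** * Greedy covering and the number of pairs split by one circle *)

Local Open Scope ring_scope.

Lemma ln_le_subr1 (R : realType) (x : R) : 0 < x -> ln x <= x - 1.
Proof.
by move=> x0; have := @le_ln1Dx R (x - 1); rewrite addrCA subrr addr0; apply; lra.
Qed.

Lemma covering_double_count (R : realType) (U X : finType)
    (cov : U -> X -> bool) (m : R) (d : nat) (Y : {set X}) :
  {in Y, forall x, m <= #|[set u | cov u x]|%:R} ->
  (forall u, #|[set x in Y | cov u x]| <= d)%N ->
  #|Y|%:R * m <= #|U|%:R * d%:R.
Proof.
move=> covm degY; rewrite -natrM.
have : (\sum_(u : U) #|[set x in Y | cov u x]| <= #|U| * d)%N.
  by rewrite -sum_nat_const; apply: leq_sum.
rewrite -(ler_nat R); apply: le_trans.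
have -> : (\sum_(u : U) #|[set x in Y | cov u x]| =
           \sum_(x in Y) #|[set u | cov u x]|)%N.
  under eq_bigr do rewrite -sum1_card big_mkcond /=.
  rewrite exchange_big /= [RHS]big_mkcond; apply: eq_bigr => x _.
  case: ifP => xY; last by rewrite big1 // => u _; rewrite inE xY.
  by rewrite -sum1_card [RHS]big_mkcond; apply: eq_bigr => u _; rewrite !inE xY.
by rewrite natr_sum mulrC mulr_natr -sumr_const; apply: ler_sum.
Qed.

(* Greedy covering (Lovasz): while some [u] covers [d] remaining elements, take
   it, at a cost of [1/d] per element; otherwise lower [d], which the double count
   [#|Y| * m <= #|U| * (d - 1)] makes cheap. *)
Lemma greedy_cover (R : realType) (U X : finType) (cov : U -> X -> bool)
    (m : R) (d : nat) (Y : {set X}) :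
  0 < m -> (0 < d)%N ->
  {in Y, forall x, m <= #|[set u | cov u x]|%:R} ->
  (forall u, #|[set x in Y | cov u x]| <= d)%N ->
  exists2 S : {set U}, {in Y, forall x, exists2 u, u \in S & cov u x} &
    #|S|%:R <= #|Y|%:R / d%:R + #|U|%:R / m * ln d%:R.
Proof.
move=> m0; elim: d Y => // d IHd Y _.
have [k] := ubnP #|Y|; elim: k Y => // k IHk Y; rewrite ltnS => Yk covm degY.
have dcount e := @covering_double_count R U X cov m e Y covm.
case: (pickP (fun u => #|[set x in Y | cov u x]| == d.+1)) => [u /eqP du|nodeg].
  pose Y' := Y :\: [set x in Y | cov u x].
  have cY' : (#|Y'| + d.+1 = #|Y|)%N.
    rewrite -(cardsID [set x in Y | cov u x] Y) addnC -du; congr (_ + _)%N.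
    by apply: eq_card => x; rewrite !inE; case: (x \in Y).
  have sY' : Y' \subset Y by apply: subsetDl.
  have [|x xY'|v|S covS cS] := IHk Y'.
  - by apply: leq_trans Yk; rewrite -cY' addnS ltnS leq_addr.
  - by apply: covm; apply: (subsetP sY').
  - apply: leq_trans (degY v); apply/subset_leq_card/subsetP => x.
    by rewrite !inE => /andP[/andP[_ ->]].
  exists (u |: S) => [x xY|].
    have [cux|ncux] := boolP (cov u x); first by exists u; rewrite ?setU11.
    have [|v vS cvx] := covS x; first by rewrite !inE xY (negPf ncux).
    by exists v; rewrite ?in_setU1 ?vS ?orbT.
  have : (#|u |: S| <= #|S| + 1)%N.
    by rewrite cardsU1 addnC leq_add2l; case: (_ \notin _).
  rewrite -(ler_nat R) natrD => /le_trans; apply.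
  rewrite -cY' natrD mulrDl divff ?pnatr_eq0 //.
  by rewrite addrAC lerD2r.
have degd u : (#|[set x in Y | cov u x]| <= d)%N.
  by have := degY u; rewrite leq_eqVlt nodeg.
(* With [d = 0] nothing in [Y] is covered, and [0 < m] forces [Y] to be empty. *)
have [d0|d0] := posnP d.
  have Y0 : Y = set0.
    apply/eqP; rewrite -cards_eq0 -leqn0 -(ler_nat R).
    by rewrite -(ler_pM2r m0) mul0r (le_trans (dcount _ degd)) // d0 mulr0.
  by exists set0 => [x|]; rewrite ?Y0 ?inE // !cards0 d0 ln1 mulr0 mul0r addr0.
have [S covS cS] := IHd Y d0 covm degd.
exists S => //; apply: le_trans cS _.
have dR : 0 < d%:R :> R by rewrite ltr0n.
have d1R : 0 < d.+1%:R :> R by rewrite ltr0n.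
(* Passing from [d.+1] to [d] raises [#|Y| / d.+1] by at most [#|U| / m / d.+1], by the double
   count; the growth of [ln] pays for this. *)
have lnd : ln d%:R <= ln d.+1%:R - d.+1%:R^-1 :> R.
  have := @ln_le_subr1 R (d%:R / d.+1%:R); rewrite divr_gt0 // => /(_ isT).
  rewrite ln_div ?posrE // -natr1.
  have -> : d%:R / (d%:R + 1) - 1 = - (d%:R + 1)^-1 :> R.
    by field; rewrite natr1 pnatr_eq0.
  lra.
have Um : 0 <= #|U|%:R / m by rewrite divr_ge0 // ltW.
have step : #|Y|%:R / d%:R <= #|Y|%:R / d.+1%:R + #|U|%:R / m / d.+1%:R.
  have -> : #|Y|%:R / d%:R = #|Y|%:R / d.+1%:R + #|Y|%:R / d%:R / d.+1%:R :> R.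
    rewrite -natr1; field.
    by rewrite natr1 !gt_eqF.
  rewrite lerD2l ler_pM2r ?invr_gt0 // ler_pdivrMr // mulrAC ler_pdivlMr //.
  exact: dcount.
apply: le_trans (lerD step (ler_wpM2l Um lnd)) _.
by rewrite mulrBr addrACA subrr addr0.
Qed.

Lemma exists_small_cover (R : realType) (U X : finType) (cov : U -> X -> bool)
    (m : R) (d : nat) (Y : {set X}) :
  0 < m -> (0 < d)%N ->
  {in Y, forall x, m <= #|[set u | cov u x]|%:R} ->
  (forall u, #|[set x in Y | cov u x]| <= d)%N ->
  exists2 S : {set U}, {in Y, forall x, exists2 u, u \in S & cov u x} &
    #|S|%:R <= #|U|%:R / m * (1 + ln d%:R).
Proof.
move=> m0 d0 covm degY; have [S covS cS] := greedy_cover m0 d0 covm degY.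
exists S => //; apply: le_trans cS _.
rewrite mulrDr mulr1 lerD2r ler_pdivrMr ?ltr0n // mulrAC ler_pdivlMr //.
exact: covering_double_count covm degY.
Qed.

(** Comparing ranks keeps one orientation of each pair. Reorienting it to put the element satisfying
    [f] first is injective, and [a * b <= (a + b) ^ 2 / 4] for the two class sizes. *)
Lemma card_split_pairs (U : finType) (f : pred U) :
  (#|[set x : U * U | (enum_rank x.1 < enum_rank x.2) && (f x.1 != f x.2)]|
   <= (#|U| * #|U|) %/ 4)%N.
Proof.
pose g (x : U * U) := if f x.1 then x else (x.2, x.1).
set E := [set x | _].
have injg : {in E &, injective g}.
  move=> [x y] [x' y']; rewrite !inE /g /= => /andP[lt _] /andP[lt' _].
  case: (f x); case: (f x') => // -[e1 e2]; last by rewrite e1 e2.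
    by rewrite e1 e2 in lt; have := ltn_trans lt lt'; rewrite ltnn.
  by rewrite e1 e2 in lt; have := ltn_trans lt lt'; rewrite ltnn.
rewrite -(card_in_imset injg).
apply: leq_trans (_ : #|setX [set x | f x] [set x | ~~ f x]| <= _)%N.
  apply/subset_leq_card/subsetP => _ /imsetP[[x y] + ->].
  by rewrite !inE /g /=; case: ifP => fx; rewrite /= ?fx => /andP[_]; case: (f y).
rewrite cardsX; have := cardsC [set x | f x].
have -> : ~: [set x | f x] = [set x | ~~ f x] by apply/setP => x; rewrite !inE.
move: #|[set x | f x]| #|[set x | ~~ f x]| => a b <-.
by rewrite leq_divRL // mulnC; exact: (nat_AGM2 a b).1.
Qed.

(** * From separating families to resolving sets of the incidence graph *)

Section ResolvingSets.
Local Open Scope nat_scope.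

Lemma gdist_lt_walk (V : finType) (e : rel V) (u v : V) :
  gdist e u v < #|V| -> has_walk e (gdist e u v) u v.
Proof.
move=> lt; have : has (fun n => has_walk e n u v) (iota 0 #|V|).
  by rewrite has_find size_iota.
by move/(nth_find 0); rewrite nth_iota.
Qed.

Variables (P : finType) (Z : {set {set P}}) (q : nat).
Hypotheses (hM : moebius_plane Z) (hq : moebius_order Z q).
Local Notation circle := {z : {set P} | z \in Z}.
Local Notation V := (inc_vertex Z).
Local Notation dist := (gdist (@inc_graph P Z)).

Definition is_point (u : V) : bool := if u is inl _ then true else false.

Lemma inc_walk_parity (u v : V) n :
  has_walk (@inc_graph P Z) n u v -> is_point v = is_point u (+) odd n.
Proof.
case/has_walkP=> p [<- + <-]; elim: p u => [|w p IHp] u /=; first by rewrite addbF.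
by case/andP=> uw /IHp->; case: u w uw => [A|z] [B|w] //=; case: (odd _).
Qed.

(** The value [#|V|] of [gdist] stands for infinity; this keeps the distances up to 3 used below
    clear of it. *)
Lemma card_inc_vertex : 5 <= #|V|.
Proof.
have q1 := order_gt1 hM hq.
by rewrite card_sum card_sig (card_points hM hq); nia.
Qed.

Lemma dist_point_circle (A : P) (z : circle) :
  (dist (inl A) (inr z) <= 1) = (A \in val z).
Proof.
apply/idP/idP => [le1|Az]; last first.
  by apply: gdist_le; apply/has_walkP; exists [:: inr z]; rewrite /= Az.
have := gdist_lt_walk (leq_ltn_trans le1 (leq_trans (isT : 1 < 5) card_inc_vertex)).
case: (dist _ _) le1 => [|[|//]] _ /has_walkP[p []].
  by move=> /size0nil->.
by case: p => [|w [|]] //= _ /andP[+ _] e; rewrite e.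
Qed.

Lemma dist_circle_circle (c z : circle) :
  (dist (inr c) (inr z) <= 2) = (val z :&: val c != set0).
Proof.
apply/idP/set0Pn => [le2|[A]]; last first.
  rewrite inE => /andP[Az Ac]; apply: gdist_le; apply/has_walkP.
  by exists [:: inl A; inr z]; rewrite /= Ac Az.
have := gdist_lt_walk (leq_ltn_trans le2 (leq_trans (isT : 2 < 5) card_inc_vertex)).
case: (dist _ _) le2 => [|[|[|//]]] _ w; last 1 first.
- case/has_walkP: w => p [sp pp lp].
  case: p sp pp lp => [|[A|w] [|w' [|? ?]]] //= _ /and3P[Ac Az _] e.
  by exists A; rewrite inE Ac andbT; rewrite e in Az.
- case/has_walkP: w => p [/size0nil-> _ [<-]]; rewrite setIid; apply/set0Pn.
  by rewrite -card_gt0 hq // (valP c).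
- by have := inc_walk_parity w.
Qed.

Lemma dist_point_circle_le3 (A : P) (z : circle) : dist (inl A) (inr z) <= 3.
Proof.
have [Az|Az] := boolP (A \in val z).
  by apply: leq_trans (_ : _ <= 1) _; rewrite ?dist_point_circle.
have /card_gt1P[B [C [Bz Cz nBC]]] : 1 < #|val z|.
  by rewrite (hq (valP z)) ltnS ltnW // (order_gt1 hM hq).
have nAB : A != B by apply: contraNneq Az => ->.
have nAC : A != C by apply: contraNneq Az => ->.
have [w [wZ Aw Bw _]] := circle_through hM nAB nAC nBC.
apply: gdist_le; apply/has_walkP.
by exists [:: inr (exist _ w wZ : circle); inl B; inr z]; rewrite /= Aw Bw Bz.
Qed.

(** Points are resolved by whether the distance to a circle is at most 1, circles by whether it is
    at most 2. A point and a circle are resolved by any [s] in [S]: the point is at finite distance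
    from [s], so equal distances would contradict bipartiteness. *)
Lemma metric_dim_le (S T : {set circle}) : S != set0 ->
  (forall A B, A != B -> exists2 z, z \in S & (A \in val z) != (B \in val z)) ->
  (forall c c' : circle, c != c' ->
     exists2 z, z \in T & separates (val z) (val c) (val c')) ->
  metric_dim (@inc_graph P Z) <= #|S| + #|T|.
Proof.
move=> /set0Pn[s sS] sepP sepC.
have mixed A (c : circle) : exists2 x, x \in inr @: (S :|: T) &
    dist (inl A) x != dist (inr c) x.
  exists (inr s); first by apply: imset_f; rewrite inE sS.
  have lt := leq_ltn_trans (dist_point_circle_le3 A s)
    (leq_trans (isT : 3 < 5) card_inc_vertex).
  apply/eqP => e; have := inc_walk_parity (gdist_lt_walk lt).
  by rewrite e in lt *; rewrite (inc_walk_parity (gdist_lt_walk lt)) /=; case: odd.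
apply: leq_trans (_ : #|inr @: (S :|: T) : {set V}| <= _); last first.
  by rewrite (leq_trans (leq_imset_card _ _)) // cardsU leq_subr.
apply: (metric_dimP _).2; apply/forall_inP => u _; apply/forall_inP => v _.
apply/implyP => uv; apply/exists_inP.
case: u v uv => [A|c] [B|c'] uv.
- have [|z zS nz] := sepP A B; first by apply: contraNneq uv => ->.
  exists (inr z); first by apply: imset_f; rewrite inE zS.
  by apply: contraNneq nz; rewrite -!dist_point_circle => ->.
- exact: mixed.
- by have [x xS] := mixed B c; exists x; rewrite // eq_sym.
have [|z zT nz] := sepC c c'; first by apply: contraNneq uv => ->.
exists (inr z); first by apply: imset_f; rewrite inE zT orbT.
apply: contraNneq nz => e; rewrite /separates -(inj_eq negb_inj).
by rewrite -!dist_circle_circle e eqxx.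
Qed.

Local Open Scope ring_scope.

Lemma metric_dim_le_log (R : realType) : (4 <= q)%N ->
  (metric_dim (@inc_graph P Z))%:R <=
    2 * q%:R - 2 +
    (q%:R * (q%:R ^+ 2 + 1)) / ((q%:R ^+ 2 - 1) * (q%:R - 3) / 2) *
    (1 + ln ((q%:R * (q%:R ^+ 2 + 1)) ^+ 2 / 4)) :> R.
Proof.
move=> q4; have q3 : (3 <= q)%N by rewrite ltnW.
have [S0 [S0Z cS0 S0n0 sepS0]] := points_separated_by_circles hM hq q3.
have cU : #|{: circle}| = (q * (q ^ 2 + 1))%N by rewrite card_sig -(card_circles hM hq).
pose S : {set circle} := [set u | val u \in S0].
have lift z (zZ : z \in Z) : exists u : circle, val u = z by exists (exist _ z zZ).
have cS : (#|S| <= 2 * q - 2)%N.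
  rewrite -(card_imset _ val_inj); apply: leq_trans cS0.
  by apply/subset_leq_card/subsetP => _ /imsetP[u + ->]; rewrite inE.
have Sn0 : S != set0.
  have /set0Pn[z zS0] := S0n0; have [u eu] := lift z (subsetP S0Z z zS0).
  by apply/set0Pn; exists u; rewrite inE eu.
have sepS A B : A != B -> exists2 z : circle, z \in S & (A \in val z) != (B \in val z).
  move=> nAB; have [z zS0 nz] := sepS0 A B nAB.
  by have [u eu] := lift z (subsetP S0Z z zS0); exists u; rewrite ?inE eu.
pose cov (z : circle) (x : circle * circle) := separates (val z) (val x.1) (val x.2).
(* Each unordered pair of circles is to be covered once. *)
pose Y := [set x : circle * circle | (enum_rank x.1 < enum_rank x.2)%N].
pose m : R := (q%:R ^+ 2 - 1) * (q%:R - 3) / 2.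
pose d := ((#|{: circle}| * #|{: circle}|) %/ 4)%N.
have x4 : 4 <= q%:R :> R by rewrite (ler_nat R 4).
have m0 : 0 < m by rewrite /m divr_gt0 // mulr_gt0 //; nra.
have d0 : (0 < d)%N by rewrite /d cU divn_gt0 //; nia.
have covm : {in Y, forall x, m <= #|[set u | cov u x]|%:R}.
  move=> [c c']; rewrite inE /= => lt.
  have cc' : val c != val c'.
    by apply: contraTneq lt => /val_inj->; rewrite ltnn.
  have := card_separating hM hq q3 (valP c) (valP c') cc'.
  have -> : #|[set z in Z | separates z (val c) (val c')]| = #|[set u | cov u (c, c')]|.
    rewrite -[RHS](card_imset _ val_inj); apply: eq_card => z; rewrite inE.
    apply/andP/imsetP => [[zZ sz]|[u + ->]]; last by rewrite inE (valP u).
    by have [u eu] := lift z zZ; exists u; rewrite // inE /cov /= eu.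
  rewrite -(ler_nat R) !natrM !natrB ?natrX ?expn_gt0 ?(ltn_trans _ q4) //.
  by rewrite /m ler_pdivrMr // [X in _ -> _ <= X]mulrC.
have degY u : (#|[set x in Y | cov u x]| <= d)%N.
  apply: leq_trans (card_split_pairs (fun c : circle => val u :&: val c == set0)).
  by apply/subset_leq_card/subsetP => x; rewrite !inE.
have [T covT cT] := exists_small_cover m0 d0 covm degY.
have sepT (c c' : circle) : c != c' ->
    exists2 z, z \in T & separates (val z) (val c) (val c').
  move=> cc'; have : (enum_rank c != enum_rank c' :> nat).
    by apply: contraNneq cc' => /val_inj/enum_rank_inj->.
  rewrite neq_ltn => /orP[lt|lt].
    by have [|u uT su] := covT (c, c'); [rewrite inE | exists u].
  have [|u uT su] := covT (c', c); [by rewrite inE | exists u => //].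
  by move: su; rewrite /cov /separates eq_sym.
have := metric_dim_le Sn0 sepS sepT.
rewrite -(ler_nat R) natrD => /le_trans; apply; apply: lerD.
  move: cS; rewrite -(ler_nat R) natrB ?natrM //.
  by rewrite (leq_trans (_ : 2 <= 2 * 1)%N) // leq_mul2l (leq_trans _ q4).
have cUR : #|{: circle}|%:R = q%:R * (q%:R ^+ 2 + 1) :> R.
  by rewrite cU natrM natrD natrX.
apply: le_trans cT _; rewrite cUR.
apply: ler_wpM2l; first by rewrite divr_ge0 ?(ltW m0) // -cUR.
rewrite lerD2l ler_ln ?posrE ?ltr0n //; last first.
  by rewrite divr_gt0 // exprn_gt0 // -cUR ltr0n cU; nia.
by rewrite ler_pdivlMr // -cUR expr2 -!natrM ler_nat leq_trunc_div.
Qed.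

End ResolvingSets.

(** * Logarithm estimates and the two explicit bounds *)

Lemma ln_succ_sqr (R : realType) (x : R) : 0 < x ->
  ln ((x * (x ^+ 2 + 1)) ^+ 2 / 4) <= ln (x ^+ 6 / 4) + 2 / x ^+ 2.
Proof.
move=> x0; have x2 : 0 < x ^+ 2 by rewrite exprn_gt0.
(* The squared factor costs at most [2 / x ^+ 2], since [ln (1 + t) <= t]. *)
have -> : (x * (x ^+ 2 + 1)) ^+ 2 / 4 = x ^+ 6 / 4 * (1 + (x ^+ 2)^-1) ^+ 2.
  by field; rewrite gt_eqF.
have pos : 0 < 1 + (x ^+ 2)^-1 by rewrite addr_gt0 ?invr_gt0.
rewrite lnM ?posrE ?divr_gt0 ?exprn_gt0 // lerD2l lnXn //.
have := ln_le_subr1 pos; rewrite addrAC subrr add0r.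
rewrite -[ln _ *+ 2]mulr_natl; lra.
Qed.

Lemma ln4_ge1 (R : realType) : 1 <= ln 4 :> R.
Proof.
have h0 : 0 < 2^-1 :> R by rewrite invr_gt0.
have := ln_le_subr1 h0; rewrite lnV ?posrE // => h.
have -> : 4 = 2 * 2 :> R by ring.
by rewrite lnM ?posrE //; lra.
Qed.

(* The tangent line of [ln] at [256], with [ln 256 = 8 (ln (3/2) + ln (4/3))]
   bounded by [8 (1/2 + 1/3)]. *)
Lemma ln_le_linear (R : realType) (x : R) : 0 < x -> ln x <= x / 256 + 17 / 3.
Proof.
move=> x0.
have h2 : ln 2 <= 1 / 2 + 1 / 3 :> R.
  have -> : 2 = 3 / 2 * (4 / 3) :> R by field.
  rewrite lnM ?posrE ?divr_gt0 //.
  have h32 : 0 < 3 / 2 :> R by lra.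
  have h43 : 0 < 4 / 3 :> R by lra.
  by have := ln_le_subr1 h32; have := ln_le_subr1 h43; lra.
have hx : 0 < x / 256 by rewrite divr_gt0.
have -> : ln x = ln (x / 256) + 8%:R * ln 2.
  by rewrite mulr_natl -lnXn // -lnM ?posrE ?exprn_gt0 //; congr ln; field.
have := ln_le_subr1 hx; lra.
Qed.

Theorem mainTheorem3 (R : realType) (P : finType) (Z : {set {set P}}) (q : nat)
  (hM : moebius_plane Z) (hq : moebius_order Z q) :
  ((4 <= q)%N ->
     (metric_dim (@inc_graph P Z))%:R <=
       2 * q%:R - 2 +
       (2 + (14 * q%:R ^+ 2 - 20 * q%:R + 6) /
            (q%:R ^+ 3 - 6 * q%:R ^+ 2 + 11 * q%:R - 2)) *
       (1 + ln (q%:R ^+ 6 / 4)) :> R)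
  /\
  ((156 <= q)%N ->
     (metric_dim (@inc_graph P Z))%:R <= 2 * q%:R + 12 * ln q%:R :> R).
Proof.
split=> hq0.
  have x4 : 4 <= q%:R :> R by rewrite (ler_nat R 4).
  apply: le_trans (metric_dim_le_log hM hq R hq0) _; rewrite lerD2l.
  move: (q%:R) x4 => x x4.
  have x0 : 0 < x by lra.
  have x1 : 1 <= x by lra.
  have x2 : 0 < x ^+ 2 by rewrite exprn_gt0.
  have L0 : 0 <= ln (x ^+ 6 / 4).
    apply: ln_ge0; rewrite ler_pdivlMr // mul1r.
    by apply: le_trans x4 _; apply: ler_eXnr.
  (* In terms of [y] the polynomials to be bounded below have only nonnegative coefficients. *)
  have [y y0 xE] : exists2 y, 0 <= y & x = y + 4 by exists (x - 4); lra.
  have D0 : 0 < x ^+ 3 - 6 * x ^+ 2 + 11 * x - 2.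
    have -> : x ^+ 3 - 6 * x ^+ 2 + 11 * x - 2 = y ^+ 3 + 6 * y ^+ 2 + 11 * y + 10.
      by rewrite xE; ring.
    have := exprn_ge0 3 y0; have := exprn_ge0 2 y0; lra.
  have M0 : 0 < (x ^+ 2 - 1) * (x - 3) by rewrite mulr_gt0 //; nra.
  set a := x * (x ^+ 2 + 1) / _; have a0 : 0 <= a.
    by apply/ltW/divr_gt0; [apply: mulr_gt0; lra | apply: divr_gt0].
  (* The additive error [2 / x ^+ 2] becomes a factor because the logarithm is nonnegative; a
     comparison of rational functions remains. *)
  apply: le_trans (_ : a * ((1 + 2 / x ^+ 2) * (1 + ln (x ^+ 6 / 4))) <= _).
    apply: ler_wpM2l => //; have := ln_succ_sqr x0.
    have : 0 <= 2 / x ^+ 2 * ln (x ^+ 6 / 4) by rewrite mulr_ge0 // divr_ge0 // ltW.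
    lra.
  rewrite mulrA; apply: ler_wpM2r; first by lra.
  have -> : a * (1 + 2 / x ^+ 2) =
      2 * (x ^+ 2 + 1) * (x ^+ 2 + 2) / (x * ((x ^+ 2 - 1) * (x - 3))).
    by rewrite /a; field; rewrite ?gt_eqF //; nra.
  have -> : 2 + (14 * x ^+ 2 - 20 * x + 6) / (x ^+ 3 - 6 * x ^+ 2 + 11 * x - 2) =
      2 * (x ^+ 2 + 1) * (x + 1) / (x ^+ 3 - 6 * x ^+ 2 + 11 * x - 2).
    by field; rewrite ?gt_eqF.
  have xM0 := mulr_gt0 x0 M0.
  rewrite (ler_pdivrMr _ _ xM0) [leRHS]mulrAC (ler_pdivlMr _ _ D0).
  rewrite -!mulrA ler_pM2l // ler_pM2l; last by lra.
  rewrite -subr_ge0.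
  have -> : (x + 1) * (x * ((x ^+ 2 - 1) * (x - 3))) -
     (x ^+ 2 + 2) * (x ^+ 3 - 6 * x ^+ 2 + 11 * x - 2) =
     4 * y ^+ 4 + 47 * y ^+ 3 + 196 * y ^+ 2 + 317 * y + 120.
    by rewrite xE; ring.
  have := exprn_ge0 4 y0; have := exprn_ge0 3 y0; have := exprn_ge0 2 y0; lra.
have hq4 : (4 <= q)%N by apply: leq_trans hq0.
have x156 : 156 <= q%:R :> R by rewrite (ler_nat R 156).
apply: le_trans (metric_dim_le_log hM hq R hq4) _.
move: (q%:R) x156 => x x156.
have x0 : 0 < x by lra.
have x2 : 0 < x ^+ 2 by rewrite exprn_gt0.
have M0 : 0 < (x ^+ 2 - 1) * (x - 3) by rewrite mulr_gt0 //; nra.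
set a := x * (x ^+ 2 + 1) / _.
(* The excess [e] of [a] over 2 is about [6 / x]. In the final inequality [12 * ln x] cancels, and
   [6 * (e * ln x)] plus small terms must stay below [2 * ln 4], which is at least 2. *)
have aE : a = 2 + (6 * x ^+ 2 + 4 * x - 6) / ((x ^+ 2 - 1) * (x - 3)).
  by rewrite /a; field; rewrite ?gt_eqF //; nra.
set e := _ / _ in aE.
have e0 : 0 <= e by rewrite /e divr_ge0 ?ltW //; nra.
have ex : e * x <= 63 / 10.
  rewrite /e mulrAC ler_pdivrMr //; nra.
have i2 : 2 / x ^+ 2 <= 1 / 1000.
  by rewrite ler_pdivrMr //; nra.
have i20 : 0 <= 2 / x ^+ 2 by rewrite divr_ge0 // ltW.
have e1 : e <= 63 / 1560.
  by rewrite -(ler_pM2r x0); nra.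
have l4 := ln4_ge1 R.
have lx := ln_le_linear x0.
(* The linear bound on [ln x] is combined with [e * x <= 63 / 10] and [e <= 63 / 1560]; six times
   the right side is about 1.52. *)
have el : e * ln x <= 63 / 2560 + 63 / 1560 * (17 / 3).
  apply: le_trans (ler_wpM2l e0 lx) _; nra.
have := ln_succ_sqr x0.
have -> : ln (x ^+ 6 / 4) = 6 * ln x - ln 4.
  by rewrite ln_div ?posrE ?exprn_gt0 // lnXn // mulr_natl.
move=> hL.
have a0 : 0 <= a by lra.
have := ler_wpM2l a0 hL; rewrite aE => hL'.
have : e * (6 * ln x - ln 4 + 2 / x ^+ 2) <= 6 * (e * ln x) - e + e * (1 / 1000).
  have := ler_wpM2l e0 l4; have := ler_wpM2l e0 i2; lra.
lra.
Qed.
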